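(* Let $A$ be a ring. Let $B$ be an $A$-algebra. Let $\alpha\in\mathbb{N}$ and $\beta\in\mathbb{N}$ be such that $\alpha+\beta\in\mathbb{N}^{+}$. Let $u\in B$ and $v\in B$. Let $s_0,s_1,\ldots,s_\alpha$ be $\alpha+1$ elements of $A$ such that $\sum_{i=0}^{\alpha}s_iv^i=u$. Let $t_0,t_1,\ldots,t_\beta$ be $\beta+1$ elements of $A$ such that $\sum_{i=0}^{\beta}t_iv^{\beta-i}=uv^\beta$. Then $u$ is $(\alpha+\beta)$-integral over $A$.
   Context: All rings are commutative with unity, and ''$A$-algebra'' means commutative unital $A$-algebra (the structure map $A\to B$ need not be injective). $\mathbb{N}=\{0,1,2,\ldots\}$ and $\mathbb{N}^{+}=\{1,2,3,\ldots\}$. For a ring $A$, an $A$-algebra $B$ and $n\in\mathbb{N}$, an element $u\in B$ is called $n$-integral over $A$ if there exists a monic polynomial $P\in A[X]$ with $\deg P=n$ (that is, $P=X^n+\sum_{k=0}^{n-1}a_kX^k$ with $a_k\in A$) and $P(u)=0$. *)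

(* Defs.v *)
From mathcomp Require Import all_boot all_algebra.
Set Implicit Arguments.
Unset Strict Implicit.
Unset Printing Implicit Defensive.
Import GRing.Theory.
Local Open Scope ring_scope.

(* [comPzRingType] and a ring morphism [f : A -> B] as the structure map, rather *)
(* than [comAlgType], because [lalgType] and its descendants (and also          *)
(* [{poly A}]) exclude the zero ring.  For the same reason the monic polynomial  *)
(* 'X^n + \sum_(k < n) a k 'X^k is given by its coefficients; see                *)
(* [n_integral_polyP] for its expression in [{poly A}].                          *)
Definition n_integral (A B : comPzRingType) (f : {rmorphism A -> B})
    (n : nat) (u : B) : Prop :=
  exists a : 'I_n -> A, u ^+ n + \sum_(k < n) f (a k) * u ^+ k = 0.

Lemma n_integral_polyP (A B : comNzRingType) (f : {rmorphism A -> B})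
    (n : nat) (u : B) :
  n_integral f n u <->
  exists P : {poly A}, [/\ P \is monic, size P = n.+1 & root (map_poly f P) u].
Proof.
split=> [[a au0]|[P [Pmon szP /rootP Pu0]]].
  pose Q := \poly_(i < n) oapp a 0 (insub i).
  have szQ : (size Q < size ('X^n : {poly A}))%N by rewrite size_polyXn ltnS size_poly.
  exists ('X^n + Q); split.
  - by rewrite monicE lead_coefDl // lead_coefXn.
  - by rewrite size_polyDl // size_polyXn.
  apply/rootP; rewrite rmorphD /= map_polyXn hornerD hornerXn -[RHS]au0.
  congr (_ + _).
  rewrite (@horner_coef_wide _ n); last first.
    exact: leq_trans (size_poly _ _) (size_poly _ _).
  by apply: eq_bigr => k _; rewrite coef_map coef_poly ltn_ord /= valK.
exists (fun k => P`_k).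
rewrite -[RHS]Pu0 (@horner_coef_wide _ n.+1); last by rewrite -szP size_poly.
rewrite big_ord_recr /= coef_map /=.
have -> : P`_n = 1 by move/monicP: Pmon; rewrite /lead_coef szP.
rewrite rmorph1 mul1r addrC; congr (_ + _).
by apply: eq_bigr => k _; rewrite coef_map.
Qed.

(* Main.v *)
Require Import Defs.
From HB Require Import structures.
From mathcomp Require Import all_boot all_algebra.
Local Open Scope ring_scope.
Import GRing.Theory.

(** Write n for alpha + beta and let U be the A-submodule of B spanned by
    1, v, ..., v ^ (n - 1). Multiplication by u maps U into itself: on v ^ k
    with k < beta, expanding u as a polynomial of degree alpha in v only
    produces exponents at most alpha + k < n, and on v ^ (beta + j) with
    j < alpha, expanding u v ^ beta only produces exponents at most
    beta + j < n ([powers_stable]). So u acts on the spanning family through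
    some n x n matrix M over A, and by the determinant trick the characteristic
    polynomial of M, which is monic of degree n, takes at u a value that kills
    the whole family ([char_poly_annihilates]). Since n > 0 the family contains
    v ^ 0 = 1, so that value is 0 ([n_integral_of_stable]). *)

(** The vector w lies in the kernel of u - M, hence, multiplying by the adjugate,
    it is killed by det (u - M), which is the characteristic polynomial of M
    evaluated at u. *)
Lemma char_poly_annihilates (A B : comNzRingType) (f : {rmorphism A -> B})
    (n : nat) (M : 'M[A]_n) (u : B) (w : 'cV[B]_n) :
  u *: w = map_mx f M *m w -> (map_poly f (char_poly M)).[u] *: w = 0.
Proof.
move=> uw; rewrite map_char_poly; set N := map_mx f M in uw *.
have -> : (char_poly N).[u] = \det (u%:M - N).
  rewrite -horner_evalE /char_poly -det_map_mx; congr (\det _).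
  apply/matrixP => i j.
  by rewrite !mxE /= horner_evalE hornerD hornerN hornerC hornerMn hornerX.
rewrite -mul_scalar_mx -mul_adj_mx -mulmxA mulmxBl mul_scalar_mx uw subrr.
exact: mulmx0.
Qed.

Lemma n_integral_of_stable_nz (A B : comNzRingType) (f : {rmorphism A -> B})
    (n : nat) (u : B) (w : 'I_n -> B) :
    (exists k, w k = 1) ->
    (forall k, exists c : 'I_n -> A, u * w k = \sum_(l < n) f (c l) * w l) ->
  n_integral f n u.
Proof.
move=> [k0 wk0] /fin_all_exists[c uw].
pose M := \matrix_(k, l) c k l; pose W := \col_k w k.
have uW : u *: W = map_mx f M *m W.
  apply/matrixP => k j; rewrite !mxE uw.
  by apply: eq_bigr => l _; rewrite !mxE.
apply/n_integral_polyP; exists (char_poly M); split.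
- exact: char_poly_monic.
- exact: size_char_poly.
have /matrixP/(_ k0 0) := char_poly_annihilates _ _ _ _ _ _ _ uW.
by rewrite !mxE wk0 mulr1 => /rootP.
Qed.

(** The type {poly A} presupposes that A is nonzero. When B is not the zero ring
    neither is A, because f maps 1 to 1, so both can be given nonzero ring
    structures; in the zero ring every equation holds. *)
Lemma n_integral_of_stable (A B : comPzRingType) (f : {rmorphism A -> B})
    (n : nat) (u : B) (w : 'I_n -> B) :
    (exists k, w k = 1) ->
    (forall k, exists c : 'I_n -> A, u * w k = \sum_(l < n) f (c l) * w l) ->
  n_integral f n u.
Proof.
have [B0 _ _|B_nz] := eqVneq (1 : B) 0.
  by exists (fun=> 0); rewrite -[LHS]mulr1 B0 mulr0.
have A_nz : (1 : A) != 0.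
  by apply: contra_neq B_nz => A0; rewrite -(rmorph1 f) A0 rmorph0.
pose mA := GRing.PzSemiRing_isNonZero.Build A A_nz.
pose mB := GRing.PzSemiRing_isNonZero.Build B B_nz.
pose A' : comNzRingType := HB.pack (GRing.ComPzRing.sort A) mA.
pose B' : comNzRingType := HB.pack (GRing.ComPzRing.sort B) mB.
exact: (@n_integral_of_stable_nz A' B' f n u w).
Qed.

Lemma sum_powers_collect (A B : comPzRingType) (f : {rmorphism A -> B})
    (m n : nat) (v : B) (a : 'I_m -> A) (e : 'I_m -> nat) :
    (forall i, e i < n)%N ->
  exists c : 'I_n -> A,
    \sum_(i < m) f (a i) * v ^+ e i = \sum_(l < n) f (c l) * v ^+ l.
Proof.
move=> e_lt; pose h i := Ordinal (e_lt i).
exists (fun l => \sum_(i | h i == l) a i).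
rewrite (partition_big h predT) //=; apply: eq_bigr => l _.
by rewrite rmorph_sum mulr_suml; apply: eq_bigr => i /eqP <-.
Qed.

(** The exponent k decides which of the two relations keeps all exponents below
    alpha + beta: the one for u when k < beta, the one for u v ^ beta otherwise. *)
Lemma powers_stable (A B : comPzRingType) (f : {rmorphism A -> B})
    (alpha beta : nat) (u v : B)
    (s : 'I_alpha.+1 -> A) (t : 'I_beta.+1 -> A) :
    \sum_(i < alpha.+1) f (s i) * v ^+ i = u ->
    \sum_(i < beta.+1) f (t i) * v ^+ (beta - i) = u * v ^+ beta ->
  forall k : 'I_(alpha + beta), exists c : 'I_(alpha + beta) -> A,
    u * v ^+ k = \sum_(l < alpha + beta) f (c l) * v ^+ l.
Proof.
move=> hs ht k; have [k_lt|k_ge] := ltnP k beta.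
  have e_lt (i : 'I_alpha.+1) : (i + k < alpha + beta)%N.
    by rewrite -addnS leq_add // -ltnS.
  have [c def_c] := sum_powers_collect _ _ f _ _ v s _ e_lt.
  exists c; rewrite -def_c.
  rewrite -hs mulr_suml; apply: eq_bigr => i _.
  by rewrite -mulrA -exprD.
have e_lt (i : 'I_beta.+1) : (beta - i + (k - beta) < alpha + beta)%N.
  apply: leq_ltn_trans (ltn_ord k).
  by rewrite -[leqRHS](subnKC k_ge) leq_add2r leq_subr.
have [c def_c] := sum_powers_collect _ _ f _ _ v t _ e_lt.
exists c; rewrite -def_c.
rewrite -{1}(subnKC k_ge) exprD mulrA -ht mulr_suml; apply: eq_bigr => i _.
by rewrite -mulrA -exprD.
Qed.

Theorem corollary1p12 (A B : comPzRingType) (f : {rmorphism A -> B})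
    (alpha beta : nat) (hab : (0 < alpha + beta)%N) (u v : B)
    (s : 'I_alpha.+1 -> A)
    (hs : \sum_(i < alpha.+1) f (s i) * v ^+ i = u)
    (t : 'I_beta.+1 -> A)
    (ht : \sum_(i < beta.+1) f (t i) * v ^+ (beta - i) = u * v ^+ beta) :
  n_integral f (alpha + beta) u.
Proof.
apply: (n_integral_of_stable _ _ _ _ _ (fun k => v ^+ k)).
  by exists (Ordinal hab).
exact: powers_stable hs ht.
Qed.
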